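(* For an integer $n\ge1$ and $0\le\lambda\le 2$ let $P_n(\lambda)=n\lambda^{n-1}I_{1-\frac{\lambda^2}{4}}\left(\frac{n+1}{2},\frac12\right)$. Then for all $\lambda\in[0,2]$, $$P_2(\lambda)=\frac{4\lambda}{\pi}\cos^{-1}\left(\frac{\lambda}{2}\right)-\frac{\lambda^2\sqrt{4-\lambda^2}}{\pi},$$ $$P_3(\lambda)=3\lambda^2-\frac{9\lambda^3}{4}+\frac{3\lambda^5}{16}.$$
   Context: For $a,b>0$ and $0\le x\le 1$, $I_x(a,b)$ is the regularized incomplete Beta function $$I_x(a,b)=\frac{\int_0^x t^{a-1}(1-t)^{b-1}\,dt}{\int_0^1 t^{a-1}(1-t)^{b-1}\,dt}.$$ *)

(* Defs.v *)
From HB Require Import structures.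
From mathcomp Require Export all_boot all_order all_algebra.
From mathcomp Require Export all_classical all_reals all_analysis.
Export numFieldNormedType.Exports.

Set Implicit Arguments.
Unset Strict Implicit.
Unset Printing Implicit Defensive.

Import Order.TTheory GRing.Theory Num.Theory.

Local Open Scope classical_set_scope.
Local Open Scope ring_scope.

(* The integrals are Lebesgue integrals, so that the endpoint singularities
   occurring when a < 1 or b < 1 need no separate treatment: for 0 < a, 0 < b and
   0 <= x <= 1 the integrand is nonnegative with finite integral, and the value
   given by powR to its factors at t = 0 and t = 1 is irrelevant. *)
Definition incomplete_beta (R : realType) (x a b : R) : R :=
  \int[@lebesgue_measure R]_(t in `[0, x])
    (t `^ (a - 1) * (1 - t) `^ (b - 1)).

(* I_x(a, b), for 0 < a, 0 < b and 0 <= x <= 1. *)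
Definition reg_incomplete_beta (R : realType) (x a b : R) : R :=
  incomplete_beta x a b / incomplete_beta 1 a b.

(* P_n(lambda), meaningful for 1 <= n and 0 <= lambda <= 2. *)
Definition P (R : realType) (n : nat) (lambda : R) : R :=
  n%:R * lambda ^+ n.-1
  * reg_incomplete_beta (1 - lambda ^+ 2 / 4) ((n%:R + 1) / 2) (1 / 2).

(* Main.v *)
Require Import Defs.
From mathcomp Require Import measurable_realfun ring lra.
Import Order.TTheory GRing.Theory Num.Theory.
Local Open Scope classical_set_scope.
Local Open Scope ring_scope.
Set Implicit Arguments.
Unset Strict Implicit.
Unset Printing Implicit Defensive.

(** For [n = 2] and [n = 3] the integrand of the incomplete beta function is
    [sqrt t / sqrt (1 - t)] and [t / sqrt (1 - t)] respectively, and both have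
    elementary antiderivatives:
      [acos (sqrt (1 - t)) - sqrt t * sqrt (1 - t)]   and
      [2/3 * sqrt (1 - t) ^+ 3 - 2 * sqrt (1 - t)].
    At [x = 1 - lambda^2 / 4] the quantity [sqrt (1 - x)] is [lambda / 2], so
    the integrals over [[0, x]] become elementary functions of [lambda]. The
    normalizing constants are the same integrals at [x = 1], namely [pi / 2]
    and [4 / 3].

    The analytic difficulty is that the integrand blows up at [t = 1], so the
    fundamental theorem of calculus for continuous integrands on a segment does
    not give the normalizing constants. The antiderivatives are nevertheless
    continuous up to [t = 1], and [ge0_Rintegral_FTC2_co] recovers the
    integral by monotone convergence. The continuity of the first
    antiderivative at [t = 0], where [sqrt (1 - t)] reaches [1] and [acos]
    stops being differentiable, comes from [acos_within_continuous]. *)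

(** Exhaust [[a, x[] by the segments [[a, x - 1/(n+1)]]: on each the integrand
    is continuous, so its integral is [F (x - 1/(n+1)) - F a] as soon as the
    segment is nondegenerate. The integrals converge to the integral over
    [[a, x[] since [f >= 0], and the right-hand sides to [F x - F a] since [F]
    is left-continuous at [x]. The
    point [x] has measure zero, so [f] may blow up there. *)
Lemma ge0_Rintegral_FTC2_co (R : realType) (f F : R -> R) (a b x : R) :
  a <= x <= b ->
  {in `[a, b[, forall t, 0 <= f t} ->
  {in `[a, b[, continuous f} ->
  {within `[a, b], continuous F} ->
  {in `]a, b[, forall t : R, is_derive t (1 : R) F (f t)} ->
  \int[@lebesgue_measure R]_(t in `[a, x]) f t = F x - F a.
Proof.
move=> /andP[]; rewrite le_eqVlt => /predU1P[<- _ _ _ _ _|ax xb f0 cf cF dF].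
  by rewrite set_itv1 Rintegral_set1 subrr.
pose A (n : nat) := `[a, x - n.+1%:R^-1]%classic : set R.
have Aco n t : A n t -> t \in `[a, b[.
  rewrite /A /= !in_itv/= => /andP[-> tx]/=.
  apply: (le_lt_trans tx); apply: lt_le_trans xb.
  by rewrite ltrBlDr ltrDl invr_gt0.
have cfA n : {within A n, continuous f}.
  by apply: continuous_in_subspaceT => t /set_mem /Aco; exact: cf.
have mfA n : measurable_fun (A n) f.
  apply: subspace_continuous_measurable_fun => //.
  exact: measurable_itv.
have Aco_bigcup : `[a, x[%classic = \bigcup_n A n by exact: itv_bnd_open_bigcup.
have intA n : a < x - n.+1%:R^-1 ->
    (\int[lebesgue_measure]_(t in A n) (f t)%:E =
     (F (x - n.+1%:R^-1))%:E - (F a)%:E)%E.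
  move=> an.
  have ltb : x - n.+1%:R^-1 < b.
    by apply: lt_le_trans xb; rewrite ltrBlDr ltrDl invr_gt0.
  have oosub t : t \in `]a, (x - n.+1%:R^-1)[ -> t \in `]a, b[.
    by rewrite !in_itv/= => /andP[-> tx]/=; exact: lt_trans ltb.
  apply: continuous_FTC2 => //; first exact: cfA.
  - have cF' : {within `[a, x - n.+1%:R^-1], continuous F}.
      apply: continuous_subspaceW cF => t /=; rewrite !in_itv/= => /andP[->]/=.
      by move=> /le_trans; apply; exact: ltW.
    have [_ Fa Fb] := proj1 (continuous_within_itvP _ an) cF'; split => //.
    by move=> t /oosub /dF [].
  - by move=> t /oosub /dF df; rewrite derive1E derive_val.
have Fcvg : F (x - n.+1%:R^-1) @[n --> \oo] --> F x.
  have cF' : {within `[a, x], continuous F}.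
    apply: continuous_subspaceW cF => t /=; rewrite !in_itv/= => /andP[->]/=.
    by move=> /le_trans; apply.
  have [_ _ Fx] := proj1 (continuous_within_itvP _ ax) cF'.
  move/cvg_at_leftP : Fx; apply; split.
    by move=> n; rewrite ltrBlDr ltrDl invr_gt0.
  rewrite -[X in _ --> X]subr0; apply: cvgB; first exact: cvg_cst.
  exact: cvg_harmonic.
rewrite /Rintegral -integral_itv_bndo_bndc; last first.
  rewrite Aco_bigcup; apply/measurable_EFinP/measurable_fun_bigcup => // n.
  exact: measurable_itv.
rewrite Aco_bigcup.
have A_incr : nondecreasing_seq A.
  apply/nondecreasing_seqP => n; rewrite subsetEset => t.
  rewrite /A /= !in_itv/=; move=> /andP[-> /le_trans]; apply; rewrite lerD2l lerN2.
  by rewrite lef_pV2 ?posrE// ler_nat.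
have fA_ge0 n t : A n t -> (0 <= (f t)%:E)%E.
  by move=> /Aco; rewrite lee_fin; exact: f0.
have cvgA := @ge0_nondecreasing_set_cvg_integral _ (measurableTypeR R) _ A
  (fun t => (f t)%:E) (@lebesgue_measure R) A_incr (fun=> measurable_itv _)
  (fun n => proj2 (measurable_EFinP _ _) (mfA n)) fA_ge0.
rewrite -(cvg_lim _ cvgA)//.
have xa0 : 0 < x - a by rewrite subr_gt0.
have -> : limn (fun n => \int[lebesgue_measure]_(t in A n) (f t)%:E)%E
      = (F x - F a)%:E; last by [].
  apply/cvg_lim => //.
  have : (F (x - n.+1%:R^-1) - F a)%:E @[n --> \oo] --> (F x - F a)%:E.
    by apply: cvg_EFin; [exact: nearW | apply: cvgB => //; exact: cvg_cst].
  apply: cvg_trans; apply: near_eq_cvg; near=> n.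
  rewrite intA ?EFinB//.
  (* the segment is nondegenerate once 1/(n+1) < x - a *)
  rewrite ltrBrDr addrC -ltrBrDr.
  near: n; exact: (near_infty_natSinv_lt (PosNum xa0)).
Unshelve. all: by end_near. Qed.

(** The inverse of a continuous injection of a segment is continuous up to the
    endpoints of the image, where [acos] has vertical tangents. *)
Lemma acos_within_continuous (R : realType) :
  {within `[(-1 : R), 1], continuous (@acos R)}.
Proof.
rewrite -[in X in `[_, X]](@cos0 R) -(@cospi R).
apply: segment_can_ge_continuous.
- exact: pi_ge0.
- by apply: continuous_subspaceT => x; exact: continuous_cos.
- by move=> x; exact: cosK.
Qed.

Lemma continuous_sqrt_onem (R : realType) :
  continuous (fun t : R => Num.sqrt (1 - t)).
Proof.
move=> t; apply: (@continuous_comp _ _ _ (fun t : R => 1 - t) Num.sqrt).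
  by apply: continuousB; [exact: cvg_cst|exact: cvg_id].
exact: sqrt_continuous.
Qed.

Lemma is_derive_sqrt_onem (R : realType) (t : R) : t < 1 ->
  is_derive t (1 : R) (fun u => Num.sqrt (1 - u)) (- (2 * Num.sqrt (1 - t))^-1).
Proof.
move=> t1.
have dB : is_derive t (1 : R) (fun u : R => 1 - u) (0 - 1) by exact: is_deriveB.
have dS := @is_derive1_sqrt R (1 - t).
rewrite subr_gt0 in dS.
have := @is_derive1_comp _ Num.sqrt (fun u : R => 1 - u) t _ _ (dS t1) dB.
by rewrite sub0r mulrN1.
Qed.

Lemma Rintegral_id_div_sqrt_onem (R : realType) (x : R) : 0 <= x <= 1 ->
  \int[@lebesgue_measure R]_(t in `[0, x]) (t / Num.sqrt (1 - t)) =
  4 / 3 - 2 * Num.sqrt (1 - x) + 2 / 3 * Num.sqrt (1 - x) ^+ 3.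
Proof.
move=> x01.
pose F (t : R) := 2 / 3 * Num.sqrt (1 - t) ^+ 3 - 2 * Num.sqrt (1 - t).
rewrite (@ge0_Rintegral_FTC2_co _ _ F _ 1)//.
- by rewrite /F subr0 sqrtr1; field.
- move=> t; rewrite in_itv/= => /andP[t0 _].
  by rewrite divr_ge0// sqrtr_ge0.
- move=> t; rewrite in_itv/= => /andP[t0 t1].
  apply: cvgM; first exact: cvg_id.
  apply: cvgV; last exact: continuous_sqrt_onem.
  by rewrite gt_eqF// sqrtr_gt0 subr_gt0.
- apply: continuous_subspaceT => t.
  have cs := @continuous_sqrt_onem R t.
  apply: cvgB; apply: cvgM; try exact: cvg_cst; try exact: cs.
  exact: cvg_comp cs (@exprn_continuous R 3 _).
- move=> t; rewrite in_itv/= => /andP[t0 t1].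
  have ds := is_derive_sqrt_onem t1.
  apply: is_derive_eq.
  have s0 : 0 < Num.sqrt (1 - t) by rewrite sqrtr_gt0 subr_gt0.
  have : Num.sqrt (1 - t) ^+ 2 = 1 - t by rewrite sqr_sqrtr ?subr_ge0 ?ltW.
  rewrite /GRing.scale/=.
  (* with s = sqrt (1 - t) as the variable, the equation is rational *)
  move: (Num.sqrt _) s0 => s s0 s2.
  rewrite (_ : t = 1 - s ^+ 2); last by rewrite s2 subKr.
  by field; rewrite gt_eqF.
Qed.

Lemma Rintegral_sqrt_div_sqrt_onem (R : realType) (x : R) : 0 <= x <= 1 ->
  \int[@lebesgue_measure R]_(t in `[0, x]) (Num.sqrt t / Num.sqrt (1 - t)) =
  acos (Num.sqrt (1 - x)) - Num.sqrt x * Num.sqrt (1 - x).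
Proof.
move=> x01.
pose F (t : R) := acos (Num.sqrt (1 - t)) - Num.sqrt t * Num.sqrt (1 - t).
rewrite (@ge0_Rintegral_FTC2_co _ _ F _ 1)//.
- by rewrite /F subr0 sqrtr1 acos1 sqrtr0 mul0r !subr0.
- move=> t; rewrite in_itv/= => /andP[t0 t1].
  apply: cvgM; first exact: sqrt_continuous.
  apply: cvgV; last exact: continuous_sqrt_onem.
  by rewrite gt_eqF// sqrtr_gt0 subr_gt0.
- apply/subspace_continuousP => t t01; apply: cvgB; last first.
    apply: cvg_within_filter.
    by apply: cvgM; [exact: sqrt_continuous | exact: continuous_sqrt_onem].
  (* continuity of acos at 1 is relative to [-1, 1], so the inner function
     has to map [0, 1] there *)
  have sB u : `[0, 1]%classic u -> `[(-1 : R), 1]%classic (Num.sqrt (1 - u)).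
    rewrite /= !in_itv/= => /andP[u0 u1].
    rewrite (le_trans _ (sqrtr_ge0 _)) ?lerN10//=.
    by rewrite -[leRHS]sqrtr1 ler_sqrt// lerBlDr lerDl.
  have /subspace_continuousP/(_ _ (sB _ t01)) ca := @acos_within_continuous R.
  apply: cvg_trans ca => U aU.
  have : \forall u \near t, `[(-1 : R), 1]%classic (Num.sqrt (1 - u)) ->
      U (acos (Num.sqrt (1 - u))).
    exact: continuous_sqrt_onem aU.
  move=> V; apply: (@filterS _ _ (nbhs_filter t) _ _ _ V) => u Uu u01.
  by apply: Uu; exact: sB.
- move=> t; rewrite in_itv/= => /andP[t0 t1].
  have ds := is_derive_sqrt_onem t1.
  have dq := is_derive1_sqrt t0.
  have s0 : 0 < Num.sqrt (1 - t) by rewrite sqrtr_gt0 subr_gt0.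
  have q0 : 0 < Num.sqrt t by rewrite sqrtr_gt0.
  have s2 : Num.sqrt (1 - t) ^+ 2 = 1 - t by rewrite sqr_sqrtr ?subr_ge0 ?ltW.
  have q2 : Num.sqrt t ^+ 2 = t by rewrite sqr_sqrtr ?ltW.
  have s1 : -1 < Num.sqrt (1 - t) < 1.
    rewrite (lt_trans _ s0) ?ltrN10//=.
    by rewrite -[ltRHS]sqrtr1 ltr_sqrt// ltrBlDr ltrDl.
  have da := is_derive1_acos s1.
  have dc :=
    @is_derive1_comp _ acos (fun u : R => Num.sqrt (1 - u)) t _ _ da ds.
  apply: is_derive_eq.
  rewrite s2 subKr /GRing.scale/=.
  have : Num.sqrt t ^+ 2 = 1 - Num.sqrt (1 - t) ^+ 2 by rewrite s2 q2 subKr.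
  move: (Num.sqrt t) (Num.sqrt (1 - t)) q0 s0 => q s q0 s0 qs.
  by field: qs; rewrite !gt_eqF.
Qed.

(** Also valid at [u = 0], where both sides are [0]: the integrands below agree
    with the power form on all of [[0, 1]], endpoint included. *)
Lemma powR_half_sub1 (R : realType) (u : R) : 0 <= u ->
  u `^ (1 / 2 - 1) = (Num.sqrt u)^-1.
Proof.
by move=> u0; rewrite -powR12_sqrt// -powRN; congr (_ `^ _); field.
Qed.

Lemma incomplete_beta_3half_half (R : realType) (x : R) : 0 <= x <= 1 ->
  incomplete_beta x ((2%:R + 1) / 2) (1 / 2) =
  acos (Num.sqrt (1 - x)) - Num.sqrt x * Num.sqrt (1 - x).
Proof.
move=> x01; rewrite -Rintegral_sqrt_div_sqrt_onem//.
apply: eq_Rintegral => t; rewrite inE/= in_itv/= => /andP[t0 tx].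
have t1 : 0 <= 1 - t by rewrite subr_ge0 (le_trans tx)//; case/andP: x01.
by rewrite powR_half_sub1// -(powR12_sqrt t0); congr (_ `^ _ / _); field.
Qed.

Lemma incomplete_beta_2_half (R : realType) (x : R) : 0 <= x <= 1 ->
  incomplete_beta x ((3%:R + 1) / 2) (1 / 2) =
  4 / 3 - 2 * Num.sqrt (1 - x) + 2 / 3 * Num.sqrt (1 - x) ^+ 3.
Proof.
move=> x01; rewrite -Rintegral_id_div_sqrt_onem//.
apply: eq_Rintegral => t; rewrite inE/= in_itv/= => /andP[t0 tx].
have t1 : 0 <= 1 - t by rewrite subr_ge0 (le_trans tx)//; case/andP: x01.
by rewrite powR_half_sub1// (_ : (3%:R + 1) / 2 - 1 = 1 :> R) ?powRr1//; field.
Qed.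

Theorem mainTheorem2 (R : realType) (lambda : R) (hlambda : 0 <= lambda <= 2) :
  P 2 lambda =
    4 * lambda / pi * acos (lambda / 2)
    - lambda ^+ 2 * Num.sqrt (4 - lambda ^+ 2) / pi
  /\
  P 3 lambda =
    3 * lambda ^+ 2 - 9 * lambda ^+ 3 / 4 + 3 * lambda ^+ 5 / 16.
Proof.
have /andP[l0 l2] := hlambda.
have x01 : 0 <= 1 - lambda ^+ 2 / 4 <= 1 by apply/andP; split; nra.
have sqrt_l : Num.sqrt (1 - (1 - lambda ^+ 2 / 4)) = lambda / 2.
  rewrite (_ : 1 - _ = (lambda / 2) ^+ 2); last by field.
  by rewrite sqrtr_sqr ger0_norm// divr_ge0.
have one01 : 0 <= (1 : R) <= 1 by rewrite ler01 lexx.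
rewrite /P /reg_incomplete_beta; split.
  have sqrt4 : Num.sqrt (4 - lambda ^+ 2) = 2 * Num.sqrt (1 - lambda ^+ 2 / 4).
    rewrite (_ : 4 - _ = 2 ^+ 2 * (1 - lambda ^+ 2 / 4)); last by field.
    by rewrite sqrtrM ?sqr_ge0// sqrtr_sqr ger0_norm.
  rewrite !incomplete_beta_3half_half// sqrt_l sqrt4.
  rewrite subrr sqrtr0 acos0 mulr0 subr0/=.
  (* pi is abstracted so that it stays an atom for field *)
  by move: (pi : R) (pi_gt0 R) => p p0; field; rewrite gt_eqF.
rewrite !incomplete_beta_2_half// sqrt_l subrr sqrtr0/=.
by field.
Qed.
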